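(* Let $k$ be a positive integer and let $G$ be a graph satisfying the NC property which is the union of $k$ pairwise edge-disjoint copies of $K_k$ (i.e. there are complete subgraphs $L_1,\dots,L_k$ of $G$, each on $k$ vertices, pairwise edge-disjoint, with $V(G)=\bigcup_i V(L_i)$ and $E(G)=\bigcup_i E(L_i)$). Then $\chi_{DP}(G)=k$.
   Context: All graphs are finite and simple; $\chi_{DP}$ is the DP-chromatic (correspondence chromatic) number. A hole of $G$ is an induced cycle of length at least $4$; $\mathcal H(G)$ is the set of holes and $\mathcal H(G,u)$ the set of holes containing $u$. A hole cover of $G$ is a nonempty $X\subseteq V(G)$ meeting every hole. A vertex $u$ satisfies the NC property in $G$ if there are no holes $H\in\mathcal H(G,u)$, $H'\in\mathcal H(G)\setminus\mathcal H(G,u)$ sharing two consecutive edges (two distinct edges with a common end vertex lying on both). A set $\mathcal C$ satisfies the NC property in $G$ if each of its vertices does and every hole contains at most one vertex of $\mathcal C$. A graph satisfies the NC property if it has a hole cover satisfying the NC property in it. *)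

(* Defs.v *)
From mathcomp Require Import all_boot.
Set Implicit Arguments.
Unset Strict Implicit.
Unset Printing Implicit Defensive.

Section Graphs.
Variables (T : finType) (e : rel T).

Definition simple_graph : Prop := symmetric e /\ irreflexive e.

Definition induced_rel (H : {set T}) : rel T :=
  fun u v => [&& e u v, u \in H & v \in H].

(* A hole: an induced cycle of length >= 4.  An induced cycle is determined
   by its vertex set H: the induced subgraph G[H] is connected and
   2-regular, with at least 4 vertices. *)
Definition is_hole (H : {set T}) : Prop :=
  [/\ 4 <= #|H|,
      (forall x, x \in H -> #|[set y in H | e x y]| = 2) &
      (forall x y, x \in H -> y \in H -> connect (induced_rel H) x y)].

Definition hole_cover (X : {set T}) : Prop :=
  X != set0 /\ forall H, is_hole H -> H :&: X != set0.

(* two holes share two consecutive edges: there are distinct edges ab, bc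
   (common end b) lying on both.  Edges of a hole (an induced cycle) are
   exactly the edges of G with both ends in it. *)
Definition share_two_consecutive_edges (H H' : {set T}) : Prop :=
  exists a b c, [/\ a != c, e a b, e b c,
                    [/\ a \in H, b \in H & c \in H] &
                    [/\ a \in H', b \in H' & c \in H']].

Definition vertex_NC (u : T) : Prop :=
  ~ exists H H', [/\ is_hole H, u \in H, is_hole H', u \notin H' &
                     share_two_consecutive_edges H H'].

Definition set_NC (C : {set T}) : Prop :=
  (forall u, u \in C -> vertex_NC u) /\
  (forall H, is_hole H -> #|H :&: C| <= 1).

Definition graph_NC : Prop :=
  exists C : {set T}, hole_cover C /\ set_NC C.

(* DP-colouring.  A k-fold correspondence cover assigns to every vertex the
   list 'I_k and to every (ordered) pair u v a relation M u v between
   L(u) and L(v) that is a matching, with M v u the converse of M u v. *)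
Definition dp_cover (k : nat) (M : T -> T -> rel 'I_k) : Prop :=
  (forall u v i j, M u v i j = M v u j i) /\
  (forall u v i j j', M u v i j -> M u v i j' -> j = j').

Definition dp_colorable (k : nat) : Prop :=
  forall M : T -> T -> rel 'I_k, dp_cover M ->
    exists f : T -> 'I_k, forall u v, e u v -> ~~ M u v (f u) (f v).

Definition dp_chromatic_number_is (k : nat) : Prop :=
  dp_colorable k /\ forall m, m < k -> ~ dp_colorable m.

End Graphs.

(* Main.v *)
Require Import Defs.
From mathcomp Require Import all_boot all_order all_algebra zify.
Import Order.TTheory GRing.Theory Num.Theory.
Set Implicit Arguments.
Unset Strict Implicit.
Unset Printing Implicit Defensive.

(** Join every [c] of the hole cover [C] to all vertices that share a hole with
    it.  This destroys every hole: by the NC property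
    the two arcs of a hole between [c] and [p] cannot be bypassed away from
    [c], so the attachments of a connected set [D] lying on no hole through [c]
    to the vertices that do are pairwise adjacent.  A clique of the resulting
    chordal graph is a clique of [G] after removal of one vertex, because two
    disjoint added edges in it would give a hole with two vertices of [C].

    A vertex in a single [L i] has degree [k - 1].  On the set [V'] of the
    other vertices every [L i] has at most [k - 1] points.  If all cliques of
    [G[V']] have fewer than [k] vertices, simplicial vertices of the chordal
    supergraph have degree less than [k].  Otherwise a clique [Q] of size at
    least [k] is in the equality case of the de Bruijn-Erdos theorem, where any
    two lines meet in [Q]; hence [V' = Q] has only [k] vertices.  In both cases
    [G] is [(k - 1)]-degenerate and greedy DP-colouring works. *)

(* [lia] without the hypotheses that are not atoms of arithmetic, on whose
   truth values it would otherwise branch. *)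
Ltac nlia :=
  repeat match goal with
  | H : ?P |- _ =>
    lazymatch type of P with Prop => idtac end;
    lazymatch P with
    | is_true (leq _ _) => fail
    | is_true (leq _ _ && leq _ _) => fail
    | is_true (leq _ _ && (leq _ _ && leq _ _)) => fail
    | is_true (@eq_op Datatypes_nat__canonical__eqtype_Equality _ _) => fail
    | is_true (~~ @eq_op Datatypes_nat__canonical__eqtype_Equality _ _) => fail
    | is_true ((@eq_op Datatypes_nat__canonical__eqtype_Equality _ _) || _) => fail
    | @eq nat _ _ => fail
    | ~ (@eq nat _ _) => fail
    | _ => clear H
    end
  end; lia.

(** * Connected sets and holes *)

Section Connected.
Variables (T : finType) (e : rel T).
Hypotheses (symE : symmetric e) (irrE : irreflexive e).
Implicit Types (W A B D : {set T}).

Definition conn W : Prop :=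
  {in W &, forall x y, connect (induced_rel e W) x y}.

Definition touch A B : Prop :=
  exists a b, [/\ a \in A, b \in B & (a == b) || e a b].

Lemma induced_rel_sym W : symmetric (induced_rel e W).
Proof. by move=> x y; rewrite /induced_rel symE [(x \in W) && _]andbC. Qed.

Lemma connect_ir_sym W x y :
  connect (induced_rel e W) x y = connect (induced_rel e W) y x.
Proof. exact: (sym_connect_sym (@induced_rel_sym W)). Qed.

Lemma connect_irS A B x y : A \subset B ->
  connect (induced_rel e A) x y -> connect (induced_rel e B) x y.
Proof.
move=> /subsetP AB; apply: connect_sub => u v /and3P[uv uA vA].
by apply: connect1; rewrite /induced_rel uv !AB.
Qed.

Lemma touchC A B : touch A B -> touch B A.
Proof. by case=> a [b [aA bB ab]]; exists b, a; split; rewrite // eq_sym symE. Qed.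

Lemma touchUl A B D : touch A D -> touch (A :|: B) D.
Proof. by case=> a [d [aA dD ad]]; exists a, d; rewrite inE aA. Qed.

Lemma conn1 x : conn [set x].
Proof. by move=> a b; rewrite !inE => /eqP-> /eqP->. Qed.

Lemma connU A B : conn A -> conn B -> touch A B -> conn (A :|: B).
Proof.
move=> cA cB [a [b [aA bB ab]]].
have ab' : connect (induced_rel e (A :|: B)) a b.
  case/orP: ab => [/eqP->//|ab]; apply: connect1.
  by rewrite /induced_rel ab !inE aA bB orbT.
have toA x : x \in A :|: B -> connect (induced_rel e (A :|: B)) x a.
  rewrite inE => /orP[xA|xB].
    by apply: connect_irS (cA _ _ xA aA); exact: subsetUl.
  apply: connect_trans (connect_irS (subsetUr A B) (cB _ _ xB bB)) _.
  by rewrite connect_ir_sym.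
move=> x y /toA xa /toA ya; apply: connect_trans xa _.
by rewrite connect_ir_sym.
Qed.

Lemma connect_touch A B x y : x \in A -> y \in B ->
  connect (induced_rel e (A :|: B)) x y -> touch A B.
Proof.
move=> xA yB /connectP[p]; elim: p x xA => [|z p IH] x xA /=.
  by move=> _ yx; exists x, x; rewrite eqxx xA -yx.
case/andP=> /and3P[xz _]; rewrite inE => /orP[zA|zB]; first exact: IH.
by move=> _ _; exists x, z; rewrite xz orbT.
Qed.

(** The vertex sequence of an induced path: adjacency is read off from positions, for every default
    [d], so that each use may choose its own. *)
Definition ipath (s : seq T) : Prop :=
  uniq s /\ forall d i j, i < size s -> j < size s ->
    e (nth d s i) (nth d s j) = (i.+1 == j) || (j.+1 == i).

(** In a path of minimal length a repeated vertex or a chord would give a shortcut. *)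
Lemma shortest_path_ipath W x y : connect (induced_rel e W) x y -> x \in W ->
  exists s, [/\ ipath (x :: s), {subset x :: s <= W} & last x s = y].
Proof.
move=> /connectP[p0 p0P y0] xW.
pose P n := [exists p : n.-tuple T, path (induced_rel e W) x p && (last x p == y)].
have exP : exists n, P n.
  by exists (size p0); apply/existsP; exists (in_tuple p0); rewrite /= p0P y0 /=.
case: (ex_minnP exP) => n /existsP[[s /= /eqP sn] /andP[sP /eqP sy]] minn {exP}.
have short q : path (induced_rel e W) x q -> last x q = y -> size s <= size q.
  move=> qP qy; rewrite sn; apply: minn; apply/existsP; exists (in_tuple q).
  by rewrite /= qP qy eqxx.
have stepP i : i < size s -> induced_rel e W (nth x (x :: s) i) (nth x s i).
  by move=> is_; apply: (pathP x sP).
have takeP i : i <= size s ->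
    path (induced_rel e W) x (take i s) /\ last x (take i s) = nth x (x :: s) i.
  move=> is_; split; first by apply: take_path.
  case: i is_ => [|i] is_ /=; first by rewrite take0.
  by rewrite (take_nth x) // last_rcons.
have dropP i : i <= size s -> path (induced_rel e W) (nth x (x :: s) i) (drop i s)
     /\ last (nth x (x :: s) i) (drop i s) = y.
  move=> is_; have [_ lt] := takeP i is_; rewrite -lt.
  move: sP sy; rewrite -{1 2}(cat_take_drop i s) cat_path last_cat.
  by case/andP.
have inW i : i <= size s -> nth x (x :: s) i \in W.
  by case: i => [|i] //= /stepP/and3P[].
exists s; split => //; last first.
  move=> z /(nthP x)[i]; rewrite /= ltnS => i_s <-; exact: inW.
have nochord i j : j <= size s -> i.+1 < j ->
    ~~ e (nth x (x :: s) i) (nth x (x :: s) j).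
  move=> js ij; apply/negP => eij.
  have [tP tl] := takeP i ltac:(lia); have [dP dl] := dropP j js.
  have := short (take i s ++ nth x (x :: s) j :: drop j s).
  rewrite cat_path last_cat tl tP /= dl dP andbT /induced_rel eij !inW; try lia.
  move=> /(_ isT erefl); rewrite size_cat /= size_take size_drop; case: ltnP; lia.
have neq i j : j <= size s -> i < j -> nth x (x :: s) i <> nth x (x :: s) j.
  move=> js ij eij.
  have [tP tl] := takeP i ltac:(lia); have [dP dl] := dropP j js.
  have := short (take i s ++ drop j s).
  rewrite cat_path last_cat tl tP /= eij dl dP.
  move=> /(_ isT erefl); rewrite size_cat size_take size_drop; case: ltnP; lia.
split.
  apply/(uniqP x) => i j; rewrite !inE /= !ltnS => is_ js eij.
  by case: (ltngtP i j) => // [/(neq _ _ js)|/(neq _ _ is_)]; rewrite eij.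
move=> d i j; rewrite /= !ltnS => is_ js.
rewrite !(set_nth_default x d) ?ltnS //.
wlog ij : i j is_ js / i <= j.
  by move=> h; case/orP: (leq_total i j) => ij; [|rewrite symE orbC]; apply: h.
case: (ltngtP i j) ij => // [ij _|-> _]; last by rewrite irrE; lia.
case: (ltngtP i.+1 j) => ij2; try lia; last first.
  by rewrite -ij2; case/and3P: (stepP i ltac:(lia)).
rewrite (negbTE (nochord _ _ js ij2)); lia.
Qed.

Lemma ipath_is_hole z s : 2 < size s -> ipath s -> z \notin s ->
  (forall d i, i < size s -> e z (nth d s i) = (i == 0) || (i.+1 == size s)) ->
  is_hole e (z |: [set x in s]).
Proof.
move=> s3 [us es] zs ez.
set Z := _ |: _.
have sZ i : i < size s -> nth z s i \in Z.
  by move=> i_s; rewrite !inE mem_nth ?orbT.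
have zZ : z \in Z by rewrite !inE eqxx.
have ZP x : x \in Z -> x = z \/ exists2 i, i < size s & x = nth z s i.
  rewrite !inE => /orP[/eqP|xs]; first by left.
  by right; exists (index x s); rewrite ?index_mem // nth_index.
have nzs i : i < size s -> (nth z s i == z) = false.
  by move=> i_s; apply: contraNF zs => /eqP <-; rewrite mem_nth.
have nthI i j : i < size s -> j < size s -> (nth z s i == nth z s j) = (i == j).
  by move=> i_s js; rewrite nth_uniq.
have deg x a b : a \in Z -> b \in Z -> a != b ->
    (forall y, y \in Z -> e x y = (y == a) || (y == b)) ->
    #|[set y in Z | e x y]| = 2.
  move=> aZ bZ ab h; suff -> : [set y in Z | e x y] = [set a; b] by rewrite cards2 ab.
  apply/setP => y; rewrite in_set in_set2; case yZ: (y \in Z) => /=; first exact: h.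
  by apply/esym/negbTE; apply: contraFN yZ => /orP[]/eqP->.
split.
- rewrite cardsU1 inE zs cardsE (card_uniqP us); lia.
- move=> x /ZP[->|[i i_s ->]].
    apply: (deg z (nth z s 0) (nth z s (size s).-1)); rewrite ?sZ ?nthI //; try lia.
    move=> y /ZP[->|[j js ->]].
      rewrite irrE !(eq_sym z) (nzs 0) ?(nzs (size s).-1); lia.
    rewrite ez // !nthI //; lia.
  have [i0|i0] := eqVneq i 0.
    apply: (deg _ z (nth z s 1)); rewrite ?sZ // 1?eq_sym ?nzs //; try lia.
    move=> y /ZP[->|[j js ->]]; first by rewrite symE ez // i0 !eqxx.
    rewrite es // nzs // nthI //; lia.
  have [i1|i1] := eqVneq i.+1 (size s).
    apply: (deg _ z (nth z s i.-1)); rewrite ?sZ // 1?eq_sym ?nzs //; try lia.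
    move=> y /ZP[->|[j js ->]]; first by rewrite symE ez // i1 !eqxx orbT.
    rewrite es // nzs // nthI //; lia.
  apply: (deg _ (nth z s i.-1) (nth z s i.+1)); rewrite ?sZ ?nthI //; try lia.
  move=> y /ZP[->|[j js ->]].
    rewrite symE ez // !(eq_sym z) (nzs i.-1) ?(nzs i.+1); lia.
  rewrite es // !nthI //; lia.
have toz x : x \in Z -> connect (induced_rel e Z) z x.
  move=> /ZP[->//|[i i_s ->]]; elim: i i_s => [|i IH] i_s.
    by apply: connect1; rewrite /induced_rel zZ sZ // ez.
  apply: connect_trans (IH _) _; first lia.
  apply: connect1; rewrite /induced_rel !sZ //; last lia.
  rewrite es //; lia.
move=> x y /toz zx /toz; apply: connect_trans.
by rewrite connect_ir_sym.
Qed.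

(** The source of all holes built below: [z] closes up a shortest path from [x] to [y] in [W], since
    it has no other neighbours there. The last conclusion records that path, which [arms_touch]
    needs. *)
Lemma hole_through W z x y :
  e z x -> e z y -> x != y -> ~~ e x y ->
  z \notin W -> (forall w, w \in W -> e z w -> w = x \/ w = y) ->
  x \in W -> connect (induced_rel e W) x y ->
  exists Z, [/\ is_hole e Z, [/\ z \in Z, x \in Z & y \in Z],
    Z \subset z |: W & connect (induced_rel e (Z :\ z)) x y].
Proof.
move=> zx zy xy nxy zW zw xW /shortest_path_ipath/(_ xW)[s [sI sW sy]].
have [us es] := sI.
have zs : z \notin x :: s by apply: contra zW => /sW.
exists (z |: [set w in x :: s]).
have yZ : y \in x :: s by rewrite -sy mem_last.
split.
- apply: ipath_is_hole => //.
    case: s {sI sW us zs yZ} sy es => [|a [|b s]] //= sy es.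
      by rewrite sy eqxx in xy.
    by have := es x 0 1; rewrite /= sy (negbTE nxy) => /(_ isT isT).
  move=> d i i_s; apply/idP/idP.
    move=> ezi; have [xi|yi] := zw _ (sW _ (mem_nth d i_s)) ezi.
      apply/orP; left; rewrite -(nth_uniq d _ _ us) //=; exact/eqP.
    apply/orP; right; rewrite /= eqSS -(nth_uniq d _ _ us) //=.
    by rewrite yi -sy (last_nth d).
  case/orP => /eqP.
    by move=> ->.
  by move=> /= [->]; rewrite -last_nth sy.
- by split; rewrite in_setU1 ?eqxx // inE ?mem_head ?yZ orbT.
- apply: setUS; apply/subsetP => w; rewrite inE; exact: sW.
apply/connectP; exists s => //.
apply/(pathP x) => i i_s.
have Zn j : j < size (x :: s) -> nth x (x :: s) j \in (z |: [set w in x :: s]) :\ z.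
  move=> js; rewrite in_setD1 in_setU1 inE mem_nth // orbT andbT.
  by apply: contra zs => /eqP <-; exact: mem_nth.
rewrite /induced_rel (Zn i) ?(Zn i.+1) //=; last by rewrite ltnS ltnW.
by rewrite (es x i i.+1) ?eqxx //= ltnS ltnW.
Qed.

End Connected.

(** * Cyclic order of a hole and its arcs *)

Section Holes.
Variables (T : finType) (e : rel T).
Hypotheses (symE : symmetric e) (irrE : irreflexive e).
Implicit Types (W A B D H Z : {set T}).

(** Converse of [ipath_is_hole]. A longest path from [c] in [H] cannot be extended, so the second
    neighbour of its last vertex is on the path, and 2-regularity forces it to be [c]. No vertex of
    this cycle has a further neighbour in [H], so it is all of [H] by connectedness. *)
Lemma hole_induced_path H c : is_hole e H -> c \in H ->
  exists s, [/\ 2 < size s, ipath e s, c \notin s,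
    (forall d i, i < size s ->
       e c (nth d s i) = (i == 0) || (i.+1 == size s)) &
    H = c |: [set x in s]].
Proof.
case=> H4 H2 Hc cH.
have deg3 x a b d : x \in H -> a \in H -> b \in H -> d \in H ->
    e x a -> e x b -> e x d -> a != b -> a != d -> b != d -> False.
  move=> xH aH bH dH xa xb xd ab ad bd.
  have : [set a; b; d] \subset [set y in H | e x y].
    by apply/subsetP => y; rewrite !inE => /orP[/orP[]|] /eqP->; apply/andP.
  move/subset_leq_card; rewrite H2 // setUC cardsU1 cards2 ab !inE.
  by rewrite negb_or eq_sym ad eq_sym bd.
have other x a : x \in H -> exists y, [/\ y \in H, e x y & y != a].
  move=> xH; have : 0 < #|[set y in H | e x y] :\ a|.
    by have := cardsD1 a [set y in H | e x y]; rewrite H2 //; case: (_ \in _); nlia.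
  by case/card_gt0P=> y; rewrite !inE => /and3P[ya yH xy]; exists y.
pose P n := [exists s : n.-tuple T, uniq (c :: s) && path (induced_rel e H) c s].
have exP : exists n, P n by exists 0; apply/existsP; exists [tuple]; rewrite /=.
have bP n : P n -> n <= #|T|.
  case/existsP=> -[s /= /eqP <-] /andP[/andP[_ us] _].
  by rewrite -(card_uniqP us) max_card.
case: (ex_maxnP exP bP) => n0 /existsP[[s /= /eqP sn0] /andP[us sP]] max {exP bP}.
have maxs y : y \notin c :: s -> induced_rel e H (last c s) y -> False.
  move=> ys ly; have := max (size s).+1; rewrite -sn0 => h.
  suff /h : P (size s).+1 by rewrite ltnn.
  apply/existsP; have sz : size (rcons s y) == (size s).+1 by rewrite size_rcons.
  exists (Tuple sz); apply/andP; split; last by rewrite /= rcons_path sP ly.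
  by rewrite -[uniq _]/(uniq (rcons (c :: s) y)) rcons_uniq ys.
set n := size s in maxs.
pose x i := nth c (c :: s) i.
have xn : x n = last c s by rewrite /x -last_nth.
have edge i : i < n -> e (x i) (x i.+1).
  by move=> i_s; case/and3P: (pathP c sP i i_s).
have xH i : i <= n -> x i \in H.
  by case: i => [|i] // i_s; case/and3P: (pathP c sP i i_s).
have xI i j : i <= n -> j <= n -> (x i == x j) = (i == j).
  by move=> i_s js; rewrite /x nth_uniq.
have xE y : y \in c :: s -> exists2 i, i <= n & y = x i.
  move=> ys; exists (index y (c :: s)); last by rewrite /x nth_index.
  by rewrite -ltnS -[n.+1]/(size (c :: s)) index_mem.
have [y [yH ny yn]] := other (x n) (x n.-1) (xH n (leqnn n)).
have ys : y \in c :: s.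
  by apply/negPn/negP => /maxs; apply; rewrite /induced_rel -xn ny yH xH.
have [i i_n yi] := xE y ys.
(* An inner vertex [x i] would have the three neighbours [x i.-1], [x i.+1] and [x n]. *)
have i0 : i = 0.
  case: (posnP i) => // ip; exfalso; rewrite {}yi in ny yn *.
  have ni : i <> n by move=> ni; rewrite ni irrE in ny.
  have ni1 : i <> n.-1 by move=> ni1; rewrite ni1 eqxx in yn.
  apply: (deg3 (x i) (x i.-1) (x i.+1) (x n)); rewrite ?xH ?xI ?edge //; try nlia.
  - by rewrite symE -{2}(prednK ip) edge //; nlia.
  - by rewrite symE.
rewrite {}i0 {i i_n} in yi; rewrite yi {ys y yH yi} in ny yn.
have n2 : 1 < n by case: (n) ny yn => [|[|m]] //=; rewrite ?irrE ?eqxx.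
have adj i j : i <= n -> j <= n -> i < j ->
    e (x i) (x j) = (i.+1 == j) || ((i == 0) && (j == n)).
  move=> i_n jn ij; case: (eqVneq i.+1 j) => [<-|ij1] /=; first by rewrite edge //; nlia.
  case: (posnP i) => [i0|ip] /=.
    case: (eqVneq j n) => [->|jn']; first by rewrite i0 symE.
    apply/negP => ej; rewrite i0 in ej ij ij1.
    apply: (deg3 (x 0) (x 1) (x n) (x j)); rewrite ?xH ?xI ?edge //; try nlia.
    by rewrite symE.
  apply/negP => ej.
  apply: (deg3 (x i) (x i.-1) (x i.+1) (x j)); rewrite ?xH ?xI ?edge //; try nlia.
  by rewrite symE -{2}(prednK ip) edge //; nlia.
have closed w z : w \in c :: s -> z \in H -> e w z -> z \in c :: s.
  move=> /xE[i i_n ->] zH ez; apply/negPn/negP => zs.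
  have zx j : j <= n -> x j != z.
    by move=> jn; apply: contraNneq zs => <-; rewrite mem_nth.
  case: (posnP i) ez => [->|ip] ez.
    apply: (deg3 (x 0) (x 1) (x n) z); rewrite ?xH ?xI ?edge ?zx //; try nlia.
    by rewrite symE.
  case: (eqVneq i n) => [i_eq|i_neq].
    rewrite i_eq in ez ip.
    apply: (deg3 (x n) (x n.-1) (x 0) z); rewrite ?xH ?xI ?zx //; try nlia.
    by rewrite symE -{2}(prednK ip) edge //; nlia.
  apply: (deg3 (x i) (x i.-1) (x i.+1) z); rewrite ?xH ?xI ?edge ?zx //; try nlia.
  by rewrite symE -{2}(prednK ip) edge //; nlia.
have Hs : H = c |: [set w in s].
  apply/setP => w; rewrite in_setU1 inE -in_cons; apply/idP/idP; last first.
    by move=> /xE[i i_n ->]; exact: xH.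
  move=> /(Hc _ _ cH)/connectP[p pP ->].
  suff h q w' : w' \in c :: s -> path (induced_rel e H) w' q -> last w' q \in c :: s.
    by apply: h pP; rewrite mem_head.
  elim: q w' => //= z q IH w' w's.
  by case/andP=> /and3P[wz _ zH] qP; apply: IH qP; apply: closed w's zH wz.
have cs : c \notin s by case/andP: us.
have us' : uniq s by case/andP: us.
exists s; split => //.
- by move: H4; rewrite Hs cardsU1 inE cs cardsE (card_uniqP us').
- split=> // d i j i_s js; rewrite !(set_nth_default c d) //.
  wlog ij : i j i_s js / i <= j.
    by move=> h; case/orP: (leq_total i j) => ij; [|rewrite symE orbC]; apply: h.
  case: (ltngtP i j) ij => // [ij _|-> _]; last by rewrite irrE; nlia.
  rewrite (adj i.+1 j.+1) //; nlia.
move=> d i i_s; rewrite (set_nth_default c d) // (adj 0 i.+1) //; nlia.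
Qed.

Lemma ipath_segment_conn s l r : ipath e s ->
  conn e [set x in s | l <= index x s <= r].
Proof.
move=> [us es]; set A := [set x in s | _].
have AP i d : i < size s -> l <= i <= r -> nth d s i \in A.
  by move=> i_s lr; rewrite inE mem_nth //= index_uniq.
have up m x : x \in A -> index x s = l + m -> connect (induced_rel e A) (nth x s l) x.
  elim: m x => [|m IH] x xA.
    by rewrite addn0 => <-; rewrite nth_index //; move: xA; rewrite inE => /andP[].
  move=> ix; move: (xA); rewrite inE => /andP[xs /andP[lx xr]].
  have xsz : index x s < size s by rewrite index_mem.
  have lm_s : l + m < size s by rewrite ix in xsz; nlia.
  have l_s : l < size s by nlia.
  have yA : nth x s (l + m) \in A by apply: AP; nlia.
  have := IH _ yA; rewrite index_uniq // (set_nth_default x) //.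
  move=> /(_ erefl)/connect_trans; apply; apply: connect1.
  rewrite /induced_rel yA xA !andbT -{2}(nth_index x xs) es //; nlia.
move=> x y xA yA.
have l_s : l < size s.
  move: xA; rewrite inE => /andP[xs].
  have : index x s < size s by rewrite index_mem.
  nlia.
have conn z : z \in A -> connect (induced_rel e A) (nth x s l) z.
  move=> zA; rewrite (set_nth_default z) //; apply: (up (index z s - l)) => //.
  by move: zA; rewrite inE => /andP[_]; nlia.
by apply: connect_trans (conn _ yA); rewrite (connect_ir_sym symE) conn.
Qed.

(* [arm c p P] is an arc leading from [p] to a neighbour of [c]. *)
Definition arm (c p : T) (P : {set T}) : Prop :=
  [/\ p \in P, conn e P, c \notin P &
    exists2 a, a \in P & e c a /\ {in P, forall b, e c b -> b = a}].

(* The two arcs of a hole between [p] and [c] cannot be joined around [p]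
   without passing through [c]. *)
Definition linked (c p : T) : Prop :=
  exists P1 P2, [/\ arm c p P1, arm c p P2 &
    forall W, conn e W -> c \notin W ->
      touch e W P1 -> touch e W P2 -> touch e W [set p]].

Lemma arm1 c p : e c p -> arm c p [set p].
Proof.
move=> cp; split; rewrite ?inE //; first exact: conn1.
  by apply: contraTneq cp => ->; rewrite irrE.
by exists p; rewrite ?inE //; split=> // b; rewrite inE => /eqP.
Qed.

Lemma adj_linked c p : e c p -> linked c p.
Proof. by move=> cp; exists [set p], [set p]; split=> //; exact: arm1. Qed.

(** The arms are the two arcs of [H] from [p] to the neighbours of [c]. If [W] touches both arcs but
    not [p], it joins them into a connected set around [p], and [hole_through] gives a hole avoiding
    [c] that contains both edges of [H] at [p], against the NC property. *)
Lemma hole_linked H c p : vertex_NC e c -> is_hole e H -> c \in H -> p \in H ->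
  p != c -> linked c p.
Proof.
move=> NC hH cH pH pc.
case: (boolP (e c p)) => [|ncp]; first exact: adj_linked.
have [s [s3 sI cs ec Hs]] := hole_induced_path hH cH.
have [us es] := sI.
have ps : p \in s by move: pH; rewrite Hs in_setU1 (negbTE pc) inE.
set n := size s in s3 ec; set i := index p s.
have i_n : i < n by rewrite index_mem.
have pE : nth c s i = p by rewrite nth_index.
have /norP[i0 i1] : ~~ ((i == 0) || (i.+1 == n)) by rewrite -(ec c i i_n) pE.
pose x j := nth c s j.
have ex j j' : j < n -> j' < n -> e (x j) (x j') = (j.+1 == j') || (j'.+1 == j).
  by move=> jn j'n; rewrite es.
have xI j j' : j < n -> j' < n -> (x j == x j') = (j == j').
  by move=> jn j'n; rewrite nth_uniq.
have xs j : j < n -> x j \in s by move=> jn; rewrite mem_nth.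
have xi j : j < n -> index (x j) s = j by move=> jn; rewrite index_uniq.
have xH j : j < n -> x j \in H by move=> jn; rewrite Hs in_setU1 inE xs ?orbT.
pose I l r := [set y in s | l <= index y s <= r].
have mI l r j : j < n -> (x j \in I l r) = (l <= j <= r).
  by move=> jn; rewrite inE xs // xi.
have IP l r y : y \in I l r -> exists2 j, y = x j & (j < n) && (l <= j <= r).
  rewrite inE => /andP[ys lr]; exists (index y s); first by rewrite /x nth_index.
  by rewrite index_mem ys.
have cI l r : c \notin I l r by rewrite inE (negbTE cs).
have Ic l r : conn e (I l r) by exact: ipath_segment_conn.
have p_x : p = x i by [].
exists (I 0 i), (I i n); split.
- split=> //; first by rewrite p_x mI //; nlia.
  exists (x 0); first by rewrite mI //; nlia.
  split; first by rewrite ec //; nlia.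
  by move=> b /IP[j ->] jn; rewrite ec => [|//]; [move=> h; congr x|]; nlia.
- split=> //; first by rewrite p_x mI //; nlia.
  exists (x n.-1); first by rewrite mI //; nlia.
  split; first by rewrite ec //; nlia.
  by move=> b /IP[j ->] jn; rewrite ec => [|//]; [move=> h; congr x|]; nlia.
move=> W cW cnW W1 W2.
case: (boolP [exists w in W, (w == p) || e w p]) => [/exists_inP[w wW wp]|].
  by exists w, p; rewrite inE eqxx.
rewrite negb_exists_in => /forall_inP nW; exfalso.
have pW w : w \in W -> (w != p) && ~~ e w p by move=> /nW; rewrite negb_or.
have touchI l r l' r' : touch e W (I l r) ->
    (forall j, j < n -> l <= j <= r -> j != i -> l' <= j <= r') -> touch e W (I l' r').
  case=> w [y [wW /IP[j -> /andP[jn jlr]] wy]] h; exists w, (x j); split=> //.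
  rewrite mI //; apply: h => //; apply: contraTneq wy => ->.
  by rewrite -p_x negb_or pW.
have t1 : touch e W (I 0 i.-1) by apply: touchI W1 _ => j; nlia.
have t2 : touch e W (I i.+1 n) by apply: touchI W2 _ => j; nlia.
pose W' := W :|: I 0 i.-1 :|: I i.+1 n.
have cW' : conn e W' by do 2?[apply: (connU symE) => //]; exact: touchUl.
have [] := @hole_through _ e symE irrE W' p (x i.-1) (x i.+1).
- by rewrite p_x ex //; nlia.
- by rewrite p_x ex //; nlia.
- by rewrite xI //; nlia.
- by rewrite ex //; nlia.
- rewrite !in_setU; apply/negP => /orP[/orP[/pW|]|]; first by rewrite eqxx.
    by rewrite p_x mI //; nlia.
  by rewrite p_x mI //; nlia.
- move=> w; rewrite !in_setU => /orP[/orP[/pW|/IP[j ->]]|/IP[j ->]].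
  + by rewrite symE => /andP[_ /negbTE->].
  + rewrite p_x => jn; rewrite ex //; last nlia.
    by move=> h; left; congr x; nlia.
  + rewrite p_x => jn; rewrite ex //; last nlia.
    by move=> h; right; congr x; nlia.
- by rewrite !in_setU mI ?leqnn ?orbT //; nlia.
- by apply: cW'; rewrite !in_setU !mI; nlia.
move=> Z [hZ [pZ x1Z x2Z] ZW _]; apply: NC; exists H, Z; split=> //.
  apply: contraL cnW => cZ; move/subsetP: ZW => /(_ _ cZ).
  by rewrite !in_setU !in_set1 eq_sym (negbTE pc) !(negbTE (cI _ _)) !orbF orFb => ->.
exists (x i.-1), p, (x i.+1); split=> //.
- by rewrite xI //; nlia.
- by rewrite p_x ex //; nlia.
- by rewrite p_x ex //; nlia.
by split=> //; apply: xH; nlia.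
Qed.
End Holes.

(** * Local chordalization *)

Section Local.
Variables (T : finType) (e : rel T).
Hypotheses (symE : symmetric e) (irrE : irreflexive e).
Implicit Types (W A B D H Z C K : {set T}).

Lemma touch1P x A : x \notin A -> touch e [set x] A -> exists2 y, y \in A & e x y.
Proof.
move=> xA [a [b [/set1P-> bA /orP[/eqP xb|xb]]]]; last by exists b.
by rewrite xb bA in xA.
Qed.

Lemma touch_dec A B : touch e A B \/ ~ touch e A B.
Proof.
case: (boolP [exists a in A, [exists b in B, (a == b) || e a b]]).
  by case/exists_inP=> a aA /exists_inP[b bB ab]; left; exists a, b.
move=> h; right=> -[a [b [aA bB ab]]]; case/negP: h.
by apply/exists_inP; exists a => //; apply/exists_inP; exists b.
Qed.

(* Otherwise [c], the two arms and [D] would carry a hole meeting [D]. *)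
Lemma arms_touch c p q D P Q :
  conn e D -> c \notin D ->
  {in D, forall d, ~~ e c d /\ forall H, is_hole e H -> c \in H -> d \notin H} ->
  touch e D [set p] -> touch e D [set q] ->
  arm e c p P -> arm e c q Q -> touch e P Q.
Proof.
move=> cD ncD hD Dp Dq [pP cP ncP [a aP [ca uP]]] [qQ cQ ncQ [b bQ [cb uQ]]].
case: (touch_dec P Q) => // nPQ; exfalso.
have DP : touch e D P by case: Dp => d [p' [dD /set1P-> dp]]; exists d, p.
have DQ : touch e D Q by case: Dq => d [q' [dD /set1P-> dq]]; exists d, q.
pose W := D :|: P :|: Q.
have cW : conn e W by do 2?[apply: (connU symE) => //]; exact: touchUl.
have aW : a \in W by rewrite !inE aP orbT.
have bW : b \in W by rewrite !inE bQ orbT.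
have nab : ~~ ((a == b) || e a b) by apply/negP => ab; apply: nPQ; exists a, b.
case/norP: nab => ab eab.
have [] := hole_through symE irrE ca cb ab eab _ _ aW (cW _ _ aW bW).
- by rewrite !inE !negb_or ncD ncP ncQ.
- move=> w; rewrite !inE => /orP[/orP[/hD[/negbTE-> //]|wP]|wQ] cw.
    by left; apply: uP.
  by right; apply: uQ.
move=> Z [hZ [cZ aZ bZ] ZW]; have /subsetP ZW' := ZW; move=> cab.
apply: nPQ; apply: (connect_touch aP bQ); apply: connect_irS cab.
apply/subsetP => w; rewrite in_setD1 => /andP[wc wZ].
have := ZW' _ wZ; rewrite !inE (negbTE wc) /= => /orP[/orP[/hD[_ h]|->//]|->];
  last by rewrite orbT.
by have := h _ hZ cZ; rewrite wZ.
Qed.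

(** By [arms_touch] every arm at [q] touches both arms of [p], hence [p] itself because [p] is
    linked to [c]. So [p] touches both arms of [q], and therefore [q]. *)
Lemma linked_adj c p q D :
  conn e D -> c \notin D ->
  {in D, forall d, ~~ e c d /\ forall H, is_hole e H -> c \in H -> d \notin H} ->
  touch e D [set p] -> touch e D [set q] ->
  linked e c p -> linked e c q -> p != q -> e p q.
Proof.
move=> cD ncD hD Dp Dq [P1 [P2 [aP1 aP2 lP]]] [Q1 [Q2 [aQ1 aQ2 lQ]]] pq.
have PQ P Q := @arms_touch c p q D P Q cD ncD hD Dp Dq.
have tQ Q : arm e c q Q -> touch e [set p] Q.
  move=> aQ; apply: (touchC symE); case: (aQ) => _ cQ ncQ _.
  by apply: lP => //; apply: (touchC symE); exact: PQ.
have ncp : c \notin [set p].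
  by rewrite inE; case: aP1 => pP1 _ + _; apply: contraNneq => ->.
have /touch1P [] := lQ _ (@conn1 _ e p) ncp (tQ _ aQ1) (tQ _ aQ2).
  by rewrite inE.
by move=> q' /set1P->.
Qed.

Lemma arm_avoiding c c' x : linked e c x -> c != c' -> x != c' -> ~~ e c' x ->
  exists2 P, arm e c x P & ~ touch e [set c'] P.
Proof.
move=> [P1 [P2 [aP1 aP2 lP]]] cc' xc' ncx.
case: (touch_dec [set c'] P1) => [t1|]; last by exists P1.
case: (touch_dec [set c'] P2) => [t2|]; last by exists P2.
have ncc' : c \notin [set c'] by rewrite inE.
have [|y /set1P->] := touch1P _ (lP _ (@conn1 _ e c') ncc' t1 t2).
  by rewrite inE eq_sym.
by rewrite (negbTE ncx).
Qed.

(** Otherwise [x] has an arm to [c] not touching [c'] and an arm to [c'] not touching [c]; together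
    with the edge [c c'] they carry a hole through [c] and [c']. *)
Lemma linked_common c c' x :
  (forall Z, is_hole e Z -> c \in Z -> c' \notin Z) -> e c c' ->
  linked e c x -> linked e c' x -> x != c -> x != c' -> e c x \/ e c' x.
Proof.
move=> no cc' lc lc' xc xc'.
case: (boolP (e c x)) => [|ncx]; first by left.
case: (boolP (e c' x)) => [|ncx']; first by right.
have nc : c != c' by apply: contraTneq cc' => ->; rewrite irrE.
have [P [xP cP ncP [a aP [ca uP]]] tP] := arm_avoiding lc nc xc' ncx'.
rewrite eq_sym in nc.
have [Q [xQ cQ ncQ [b bQ [cb uQ]]] tQ] := arm_avoiding lc' nc xc ncx.
have nP w : w \in P -> (c' != w) && ~~ e c' w.
  by move=> wP; rewrite -negb_or; apply/negP => h; apply: tP; exists c', w; rewrite inE.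
have nQ w : w \in Q -> (c != w) && ~~ e c w.
  by move=> wQ; rewrite -negb_or; apply/negP => h; apply: tQ; exists c, w; rewrite inE.
pose W := Q :|: P :|: [set c'].
have cW : conn e W.
  apply: (connU symE); first by apply: (connU symE) => //; exists x, x; rewrite eqxx.
    exact: conn1.
  by exists b, c'; rewrite !inE bQ eqxx symE cb orbT.
have c'W : c' \in W by rewrite !inE eqxx orbT.
have aW : a \in W by rewrite !inE aP orbT.
have /andP[c'a nc'a] := nP _ aP.
have [] := hole_through symE irrE cc' ca c'a nc'a _ _ c'W (cW _ _ c'W aW).
- rewrite !inE (negbTE ncP) eq_sym (negbTE nc) !orbF.
  by apply/negP => /nQ; rewrite eqxx.
- move=> w; rewrite !inE => /orP[/orP[/nQ/andP[_ /negbTE->//]|wP]|/eqP->] cw.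
    by right; apply: uP.
  by left.
by move=> Z [hZ [cZ c'Z _] _ _]; have := no _ hZ cZ; rewrite c'Z.
Qed.

(** Boolean form, so that a [rel] can quantify over holes. *)
Definition is_holeb H : bool :=
  [&& 4 <= #|H|, [forall x in H, #|[set y in H | e x y]| == 2] &
      [forall x in H, forall y in H, connect (induced_rel e H) x y]].

Lemma is_holeP H : reflect (is_hole e H) (is_holeb H).
Proof.
apply: (iffP and3P) => -[H4 H2 Hc]; split=> //.
- by move=> x xH; apply/eqP; apply: (forall_inP H2).
- by move=> x y xH yH; apply: (forall_inP (forall_inP Hc x xH)).
- by apply/forall_inP => x xH; apply/eqP/H2.
- by apply/forall_inP => x xH; apply/forall_inP => y yH; apply: Hc.
Qed.

Definition local_chordalization (c : T) : rel T := fun x y =>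
  e x y || [&& x != y, (x == c) || (y == c) &
            [exists H : {set T}, [&& is_holeb H, x \in H & y \in H]]].

Lemma local_chordalizationP c x y :
  local_chordalization c x y -> e x y \/
  [/\ x != y, x = c \/ y = c & exists H, [/\ is_hole e H, x \in H & y \in H]].
Proof.
case/orP; first by left.
case/and3P=> xy xyc /existsP[H /and3P[/is_holeP hH xH yH]]; right; split=> //.
  by case/orP: xyc => /eqP; [left|right].
by exists H.
Qed.

Lemma local_chordalization_sym c : symmetric (local_chordalization c).
Proof.
move=> x y; rewrite /local_chordalization symE eq_sym; congr (_ || [&& _, _ & _]).
  by rewrite orbC.
by apply: eq_existsb => H; rewrite [(x \in H) && _]andbC.
Qed.

Lemma local_chordalization_irr c : irreflexive (local_chordalization c).
Proof. by move=> x; rewrite /local_chordalization irrE eqxx. Qed.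

Lemma local_chordalization_id c x y : x != c -> y != c ->
  local_chordalization c x y = e x y.
Proof.
by move=> xc yc; rewrite /local_chordalization (negbTE xc) (negbTE yc) andbF orbF.
Qed.

(** On a new hole through [c], the two neighbours of [c] are linked to [c] in [e], while the other
    vertices form a connected set whose members share no hole of [e] with [c]. So [linked_adj] joins
    the two neighbours by a chord. Between vertices other than [c] adjacency is unchanged. *)
Lemma local_chordalization_hole c Z : vertex_NC e c ->
  is_hole (local_chordalization c) Z -> is_hole e Z /\ c \notin Z.
Proof.
move=> NC hZ; set e' := local_chordalization c in hZ *.
have e'E := @local_chordalization_id c.
have cZ : c \notin Z.
  apply/negP => cZ.
  have sym' := local_chordalization_sym c.
  have irr' := @local_chordalization_irr c.
  have [s [s3 sI cs ec Zs]] := hole_induced_path sym' irr' hZ cZ.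
  have [us es] := sI.
  set n := size s in s3 ec; pose x i := nth c s i.
  have ex i j : i < n -> j < n -> e (x i) (x j) = (i.+1 == j) || (j.+1 == i).
    have xc k : k < n -> x k != c.
      by move=> kn; apply: contraNneq cs => <-; rewrite mem_nth.
    by move=> i_n jn; rewrite -(e'E (x i) (x j)) ?xc // /e' es.
  have xI i j : i < n -> j < n -> (x i == x j) = (i == j).
    by move=> i_n jn; rewrite nth_uniq.
  have e'c i : i < n -> e' c (x i) = (i == 0) || (i.+1 == n) by exact: ec.
  have lk i : i < n -> e' c (x i) -> linked e c (x i).
    move=> i_n; case/local_chordalizationP=> [|[cx _ [H [hH cH xH]]]].
      exact: adj_linked.
    by apply: (hole_linked symE irrE NC hH cH xH); rewrite eq_sym.
  have sI' : ipath e s.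
    split=> // d i j i_n jn; rewrite !(set_nth_default c d) //; exact: ex.
  pose D := [set y in s | 1 <= index y s <= n.-2].
  have DP y : y \in D -> exists2 i, y = x i & (i < n) && ((1 <= i) && (i <= n.-2)).
    rewrite inE => /andP[ys ?]; exists (index y s); first by rewrite /x nth_index.
    by rewrite index_mem ys.
  have xD i : i < n -> 1 <= i <= n.-2 -> x i \in D.
    by move=> i_n h; rewrite inE mem_nth // index_uniq.
  have : e (x 0) (x n.-1).
    apply: (@linked_adj c (x 0) (x n.-1) D).
    - exact: ipath_segment_conn.
    - by rewrite inE (negbTE cs).
    - move=> _ /DP[i -> h].
      have : ~~ e' c (x i) by rewrite e'c; nlia.
      rewrite negb_or => /andP[ncx]; rewrite eqxx /= => h2; split=> // H hH cH.
      apply: contra h2 => xH; apply/andP; split.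
        by apply: contraNneq cs => ->; rewrite mem_nth //; case/andP: h.
      by apply/existsP; exists H; rewrite cH xH; apply/andP; split=> //; apply/is_holeP.
    - exists (x 1), (x 0); split; rewrite ?xD ?inE //; try nlia.
      by rewrite ex ?orbT //; nlia.
    - exists (x n.-2), (x n.-1); split; rewrite ?xD ?inE //; try nlia.
      by apply/orP; right; rewrite ex //; nlia.
    - by apply: lk; rewrite ?e'c; nlia.
    - by apply: lk; rewrite ?e'c; nlia.
    by rewrite xI; nlia.
  rewrite ex; nlia.
split=> //; case: hZ => Z4 Z2 Zc.
have eZ x y : x \in Z -> y \in Z -> e' x y = e x y.
  by move=> xZ yZ; rewrite /e' e'E //; apply: contraNneq cZ => <-.
split=> //.
  move=> x xZ; rewrite -(Z2 x xZ); congr #|pred_of_set _|; apply/setP => y.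
  by rewrite !inE; case yZ: (y \in Z) => //=; rewrite eZ.
move=> x y xZ yZ; have := Zc x y xZ yZ; apply: connect_sub => u v /and3P[uv uZ vZ].
by apply: connect1; rewrite /induced_rel -eZ // uv uZ.
Qed.

End Local.

(** * Chordal supergraphs, simplicial vertices and greedy colouring *)

Section Chordal.
Variable T : finType.
Implicit Types (e : rel T) (A B C H K U Z : {set T}).

(** Induction on [C], one vertex [c] at a time: every hole left is a hole of [e] avoiding [c], so
    [C :\ c] still meets it and keeps the NC property. The covering hypothesis allows [C] to be
    empty, where the induction ends. *)
Lemma chordalization e C : symmetric e -> irreflexive e ->
  (forall H, is_hole e H -> H :&: C != set0) -> set_NC e C ->
  exists e' : rel T,
    [/\ symmetric e' /\ irreflexive e', subrel e e',
      forall Z, ~ is_hole e' Z &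
      forall x y, e' x y -> e x y \/
        ((x \in C) || (y \in C)) /\
        exists H, [/\ is_hole e H, x \in H & y \in H]].
Proof.
have [n] := ubnP #|C|; elim: n C e => // n IH C e Cn sym irr cov [NC1 NC2].
have [C0|[c cC]] := set_0Vmem C.
  exists e; split=> // [Z /cov|x y]; last by left.
  by rewrite C0 setI0 eqxx.
have hole1 := local_chordalization_hole sym irr (NC1 c cC).
set e1 := local_chordalization e c in hole1.
have [|||||e' [si sub nh e'P]] := IH (C :\ c) e1.
- by move: Cn; rewrite (cardsD1 c C) cC; lia.
- exact: local_chordalization_sym.
- exact: local_chordalization_irr.
- move=> H /hole1[/cov/set0Pn[x] + cH]; rewrite inE => /andP[xH xC].
  apply/set0Pn; exists x; rewrite !inE xH xC !andbT.
  by apply: contraNneq cH => <-.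
- split=> [u|H /hole1[/NC2 H1 _]]; last first.
    by apply: leq_trans H1; apply: subset_leq_card; rewrite setIS // subsetDl.
  rewrite !inE => /andP[_ uC] [H [H' [/hole1[hH cH] uH /hole1[hH' _] uH' sh]]].
  apply: (NC1 u uC); exists H, H'; split=> //.
  case: sh => a [b [d [ad ab bd [aH bH dH] h]]]; exists a, b, d; split=> //.
    by rewrite -(@local_chordalization_id _ e c) //; apply: contraNneq cH => <-.
  by rewrite -(@local_chordalization_id _ e c) //; apply: contraNneq cH => <-.
exists e'; split=> //.
  by move=> x y xy; apply: sub; rewrite /e1 /local_chordalization xy.
move=> x y /e'P[/local_chordalizationP[|[_ xyc h]]|[xyC [H [/hole1[hH _] xH yH]]]].
- by left.
- by right; split=> //; case: xyc => ->; rewrite cC ?orbT.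
right; split; last by exists H.
by move: xyC; rewrite !inE => /orP[]/andP[_ ->]; rewrite ?orbT.
Qed.

(** Dirac's theorem for the subgraph on [U]. If [U] is no clique, take a connected [B] maximal
    subject to leaving some vertex of [U] far from it; a vertex simplicial within the set [A] of far
    vertices is simplicial in [U]. *)
Lemma chordal_simplicial e U : symmetric e -> irreflexive e ->
  (forall Z, ~ is_hole e Z) -> U != set0 ->
  exists2 v, v \in U &
    {in U &, forall x y, e v x -> e v y -> x != y -> e x y}.
Proof.
move=> sym irr nh.
have [n] := ubnP #|U|; elim: n U => // n IH U Un U0.
case: (boolP [forall x in U, forall y in U, (x != y) ==> e x y]) => [h|].
  have [v vU] := set0Pn _ U0; exists v => // x y xU yU _ _ xy.
  by move/forall_inP: h => /(_ x xU)/forall_inP/(_ y yU)/implyP/(_ xy).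
rewrite negb_forall_in => /exists_inP[a aU].
rewrite negb_forall_in => /exists_inP[b bU]; rewrite negb_imply => /andP[ab nab].
pose far B z := [&& z \in U, z \notin B & [forall b in B, ~~ e b z]].
pose P B := [&& B != set0, B \subset U, [exists z, far B z] &
  [forall x in B, forall y in B, connect (induced_rel e B) x y]].
have Pa : P [set a].
  apply/and4P; split.
  - by apply/set0Pn; exists a; rewrite inE.
  - by rewrite sub1set.
  - apply/existsP; exists b; rewrite /far bU inE eq_sym ab.
    by apply/forall_inP => ?; rewrite inE => /eqP->.
  - by apply/forall_inP => x xa; apply/forall_inP => y ya; apply: conn1.
have [B /maxsetP[/and4P[B0 BU /existsP[z0 fz0] cB] maxB] _] := maxset_exists Pa.
have cnB : conn e B by move=> x y xB yB; apply: (forall_inP (forall_inP cB x xB)).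
pose A := [set z | far B z].
have AU : A \subset U by apply/subsetP => z; rewrite inE => /and3P[].
(* Such an [x] has a neighbour in [B]; if it missed [w], adding it to [B] would contradict
   maximality. *)
have BS x w : x \in U -> x \notin B -> x \notin A -> w \in A -> e x w.
  move=> xU xB xA; rewrite inE => /and3P[wU wB fw].
  have [y yB yx] : exists2 y, y \in B & e y x.
    move: xA; rewrite inE /far xU xB /= negb_forall_in => /exists_inP[y yB].
    by rewrite negbK; exists y.
  apply/negPn/negP => nxw; have := maxB (B :|: [set x]).
  move=> /(_ _ (subsetUl _ _)) h; case/negP: xB; rewrite -h ?inE ?eqxx ?orbT //.
  apply/and4P; split.
  - by apply/set0Pn; exists x; rewrite !inE eqxx orbT.
  - by rewrite subUset BU sub1set.
  - apply/existsP; exists w; rewrite /far wU !inE negb_or wB /=; apply/andP; split.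
      apply: contraTneq yx => <-; exact: (forall_inP fw).
    apply/forall_inP => u; rewrite !inE => /orP[uB|/eqP->//]; exact: (forall_inP fw).
  - have cnBx : conn e (B :|: [set x]).
      apply: (connU sym) => //; first exact: conn1.
      by exists y, x; rewrite inE yx orbT.
    by apply/forall_inP => ? ?; apply/forall_inP => ? ?; apply: cnBx.
have [||v vA vs] := IH A.
- apply: leq_trans (_ : #|U| <= n); last by rewrite -ltnS.
  apply: proper_card; rewrite properE AU; have [w wB] := set0Pn _ B0.
  apply/subsetPn; exists w; first exact: (subsetP BU).
  by rewrite inE /far wB andbF.
- by apply/set0Pn; exists z0; rewrite inE.
move: (vA); rewrite inE => /and3P[vU vB fv].
exists v => // x y xU yU vx vy xy.
have nB w : e v w -> w \notin B.
  by move=> vw; apply: contraL vw => /(forall_inP fv); rewrite sym.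
case: (boolP (x \in A)) => xA; case: (boolP (y \in A)) => yA.
- exact: vs.
- by rewrite sym BS // nB.
- by rewrite BS // nB.
(* Both [x] and [y] now lie outside [A], so they have neighbours in [B]; if nonadjacent, they would
   close a hole with [v] through [B]. *)
apply/negPn/negP => nxy.
have nbr w : w \in U -> w \notin A -> e v w -> touch e [set w] B.
  move=> wU wA vw; move: wA.
  rewrite inE /far wU nB //= negb_forall_in => /exists_inP[u uB].
  by rewrite negbK => uw; exists w, u; rewrite inE eqxx uB sym uw orbT.
have cW : conn e ([set x] :|: B :|: [set y]).
  apply: (connU sym); [apply: (connU sym) => //; [exact: conn1|exact: nbr]|exact: conn1|].
  rewrite setUC; apply: touchUl; apply: (touchC sym); exact: nbr.
have [|||||Z [hZ _ _ _]] :=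
  hole_through sym irr vx vy xy nxy _ _ _ (cW x y _ _); rewrite ?inE ?eqxx ?orbT //.
- rewrite !negb_or vB andbT; apply/andP; split.
    by apply: contraTneq vx => ->; rewrite irr.
  by apply: contraTneq vy => ->; rewrite irr.
- move=> w; rewrite !inE => /orP[/orP[/eqP->|wB]|/eqP->]; [by left| |by right].
  by move=> /nB; rewrite wB.
exact: nh hZ.
Qed.

(** Every pair of [K] nonadjacent in [e] contains a vertex of [C]; by [badU] this vertex is the same
    for all such pairs, so deleting it leaves a clique of [e]. *)
Lemma chordalization_clique e e' C K :
  symmetric e -> irreflexive e -> set_NC e C ->
  (forall x y, e' x y -> e x y \/ ((x \in C) || (y \in C)) /\
     exists H, [/\ is_hole e H, x \in H & y \in H]) ->
  {in K &, forall x y, x != y -> e' x y} ->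
  exists K', [/\ K' \subset K, #|K| <= #|K'|.+1 &
    {in K' &, forall x y, x != y -> e x y}].
Proof.
move=> sym irr [NC1 NC2] e'P clK.
pose bad c x := [&& c \in C, c \in K, x \in K, c != x & ~~ e c x].
have two Z c c' : is_hole e Z -> c \in C -> c' \in C -> c != c' ->
    c \in Z -> c' \notin Z.
  move=> hZ cC c'C cc' cZ; apply/negP => c'Z.
  have := NC2 _ hZ; rewrite leqNgt => /negP; apply.
  have <- : #|[set c; c']| = 2 by rewrite cards2 cc'.
  apply: subset_leq_card; apply/subsetP => y.
  by rewrite !inE => /orP[]/eqP->; apply/andP.
have badH c x : bad c x -> exists H, [/\ is_hole e H, c \in H & x \in H].
  case/and5P=> _ cK xK cx ncx; have [|[_ h]] := e'P _ _ (clK _ _ cK xK cx); last by [].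
  by rewrite (negbTE ncx).
have badC c x : bad c x -> x \notin C.
  move=> b; have [H [hH cH xH]] := badH _ _ b; case/and5P: b => cC _ _ cx _.
  by apply/negP => xC; have := two _ _ _ hH cC xC cx cH; rewrite xH.
have badL c x : bad c x -> linked e c x.
  move=> b; have [H [hH cH xH]] := badH _ _ b; case/and5P: b => cC _ _ cx _.
  by apply: (hole_linked sym irr (NC1 c cC) hH cH xH); rewrite eq_sym.
(* Different [c] and [c'] are adjacent, as no hole contains both, and [linked_common] excludes a
   common partner. Then [c], [c'], [x], [x'] form an induced 4-cycle in this order, a hole with two
   vertices of [C]. *)
have badU c x c' x' : bad c x -> bad c' x' -> c = c'.
  move=> b b'; apply/eqP/negPn/negP => cc'.
  have [/and5P[cC cK xK cx ncx] /and5P[c'C c'K x'K cx' ncx']] := (b, b').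
  have no Z hZ := @two Z c c' hZ cC c'C cc'.
  have ecc' : e c c'.
    have [//|[_ [H [hH cH c'H]]]] := e'P _ _ (clK _ _ cK c'K cc').
    by have := no _ hH cH; rewrite c'H.
  have common y : bad c y -> bad c' y -> False.
    move=> by_ by'; have [/and5P[_ _ _ cy ncy] /and5P[_ _ _ c'y nc'y]] := (by_, by').
    have := linked_common sym irr no ecc' (badL _ _ by_) (badL _ _ by').
    by rewrite eq_sym cy eq_sym c'y (negbTE ncy) (negbTE nc'y) => -[].
  have xx' : x != x' by apply/eqP => xx'; apply: (common x) => //; rewrite xx'.
  have exx' : e x x'.
    have [//|[]] := e'P _ _ (clK _ _ xK x'K xx').
    by rewrite (negbTE (badC _ _ b)) (negbTE (badC _ _ b')).
  have ecx' : e c x'.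
    apply/negPn/negP => h; apply: (common x') => //; apply/and5P; split=> //.
    by apply: contraNneq (badC _ _ b') => <-.
  have ec'x : e c' x.
    apply/negPn/negP => h; apply: (common x) => //; apply/and5P; split=> //.
    by apply: contraNneq (badC _ _ b) => <-.
  have cW : conn e ([set c'] :|: [set x] :|: [set x']).
    apply: (connU sym); [apply: (connU sym)| |]; try exact: conn1.
      by exists c', x; rewrite !inE ec'x !eqxx orbT.
    by exists x, x'; rewrite !inE exx' !eqxx !orbT.
  have [|||||Z [hZ [cZ c'Z _] _ _]] :=
    hole_through sym irr ecc' ecx' cx' ncx' _ _ _ (cW c' x' _ _);
    rewrite ?inE ?eqxx ?orbT //.
  - by rewrite !negb_or cc' cx /=; apply: contraTneq ecx' => ->; rewrite irr.
  - move=> w; rewrite !inE => /orP[/orP[]|]/eqP->.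
    + by left.
    + by rewrite (negbTE ncx).
    + by right.
  by have := no _ hZ cZ; rewrite c'Z.
have badE x y : x \in K -> y \in K -> x != y -> ~~ e x y -> bad x y \/ bad y x.
  move=> xK yK xy nxy; have [|[/orP[xC|yC] _]] := e'P _ _ (clK _ _ xK yK xy).
  - by rewrite (negbTE nxy).
  - by left; apply/and5P.
  - by right; apply/and5P; split; rewrite // 1?eq_sym 1?sym.
case: (boolP [exists c, [exists x, bad c x]]) => [/existsP[c /existsP[x b]]|nb].
  exists (K :\ c); split; first exact: subsetDl.
    by rewrite (cardsD1 c K); case: (c \in K).
  move=> u w; rewrite !inE => /andP[uc uK] /andP[wc wK] uw.
  apply/negPn/negP => nuw; have [b'|b'] := badE _ _ uK wK uw nuw.
    by rewrite (badU _ _ _ _ b b') eqxx in uc.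
  by rewrite (badU _ _ _ _ b b') eqxx in wc.
exists K; split=> // u w uK wK uw; apply/negPn/negP => nuw; case/negP: nb.
by have [b|b] := badE _ _ uK wK uw nuw; apply/existsP; [exists u|exists w];
  apply/existsP; [exists w|exists u].
Qed.

(** Colour a vertex of small degree last: since [M] consists of matchings, each coloured neighbour
    forbids at most one colour there. *)
Lemma greedy_dp_colorable e k : symmetric e -> irreflexive e -> 0 < k ->
  (forall U, U != set0 -> exists2 v, v \in U & #|[set w in U | e v w]| < k) ->
  dp_colorable e k.
Proof.
move=> sym irr k0 degen M [Msym Mmat].
suff h U : exists f : T -> 'I_k,
    {in U &, forall u v, e u v -> ~~ M u v (f u) (f v)}.
  by have [f fP] := h setT; exists f => u v; apply: fP.
have [n] := ubnP #|U|; elim: n U => // n IH U Un.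
have [->|[x0 x0U]] := set_0Vmem U.
  by exists (fun=> Ordinal k0) => u v; rewrite inE.
have [v vU vk] := degen U (introT (set0Pn _) (ex_intro _ x0 x0U)).
have [|f fP] := IH (U :\ v).
  by move: Un; rewrite (cardsD1 v U) vU; lia.
pose N := [set w in U | e v w].
(* The colour that [w] forbids at [v]. If there is none, the default still excludes only one colour
   per neighbour, so fewer than [k] in all. *)
pose col w := odflt (Ordinal k0) [pick j | M w v (f w) j].
have /subsetPn[j _ jN] : ~~ ([set: 'I_k] \subset col @: N).
  apply: contraL vk => /subset_leq_card; rewrite cardsT card_ord -leqNgt => h.
  exact: leq_trans h (leq_imset_card _ _).
have jP w : w \in U -> e v w -> ~~ M w v (f w) j.
  move=> wU vw; apply: contra jN => Mj; apply/imsetP; exists w; first by rewrite inE wU.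
  rewrite /col; case: pickP => [j' Mj'|/(_ j)]; last by rewrite Mj.
  exact: Mmat Mj Mj'.
exists (fun u => if u == v then j else f u) => u w uU wU uw.
case: (eqVneq u v) => [uv|uv]; case: (eqVneq w v) => [wv|wv].
- by rewrite uv wv irr in uw.
- by rewrite uv Msym jP // -uv.
- by rewrite wv jP // -wv sym.
by apply: fP; rewrite // !inE ?uv ?wv.
Qed.

End Chordal.

(** * The equality case of the de Bruijn-Erdos theorem *)

Section Conway.
Variables (T I : finType) (Q : {set T}) (R : T -> I -> bool).
Let d v := #|[set i | R v i]|.
Let t i := #|[set v in Q | R v i]|.
Hypotheses (Q0 : 0 < #|Q|) (I0 : 0 < #|I|).
Hypotheses (d0 : {in Q, forall v, 0 < d v}) (t0 : forall i, 0 < t i).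
Hypothesis le_dt : {in Q, forall v i, R v i -> #|Q| * d v <= #|I| * t i}.

(* Conway's weights: both [1 / (|Q| d v)] and [1 / (|I| t i)] sum to 1 over the
   pairs of [R]. *)
Lemma conway_weights : {in Q, forall v i, R v i -> #|Q| * d v = #|I| * t i}.
Proof.
move=> v0 v0Q i0 Ri0.
pose x v : rat := ((#|Q| * d v)%N%:R^-1)%R.
pose y i : rat := ((#|I| * t i)%N%:R^-1)%R.
pose P (p : T * I) := (p.1 \in Q) && R p.1 p.2.
have sx : (\sum_(p | P p) x p.1 = 1)%R.
  rewrite -(pair_big_dep (fun v => v \in Q) (fun v i => R v i) (fun v i => x v)) /=.
  transitivity (\sum_(v in Q) (#|Q|%:R^-1 : rat))%R.
    apply: eq_bigr => v vQ.
    transitivity (\sum_(i in [set i | R v i]) x v)%R.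
      by apply: eq_bigl => i; rewrite inE.
    rewrite sumr_const -/(d v) -[LHS]mulr_natr /x natrM invfM mulfVK //.
    by rewrite pnatr_eq0 -lt0n d0.
  by rewrite sumr_const -[LHS]mulr_natr mulVf // pnatr_eq0 -lt0n.
have sy : (\sum_(p | P p) y p.2 = 1)%R.
  rewrite -(pair_big_dep (fun v => v \in Q) (fun v i => R v i) (fun v i => y i)) /=.
  rewrite (exchange_big_dep predT) //=.
  transitivity (\sum_(i : I) (#|I|%:R^-1 : rat))%R.
    apply: eq_bigr => i _.
    transitivity (\sum_(v in [set v in Q | R v i]) y i)%R.
      by apply: eq_bigl => v; rewrite inE.
    rewrite sumr_const -/(t i) -[LHS]mulr_natr /y natrM invfM mulfVK //.
    by rewrite pnatr_eq0 -lt0n t0.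
  by rewrite sumr_const -[LHS]mulr_natr mulVf // pnatr_eq0 -lt0n.
have pos v : v \in Q -> (0 < (#|Q| * d v)%N%:R :> rat)%R.
  by move=> vQ; rewrite ltr0n muln_gt0 Q0 d0.
have pos' i : (0 < (#|I| * t i)%N%:R :> rat)%R by rewrite ltr0n muln_gt0 I0 t0.
have ge0 p : P p -> (0 <= x p.1 - y p.2)%R.
  case/andP=> pQ Rp; rewrite subr_ge0 /x /y lef_pV2 ?posrE ?pos //.
  by rewrite ler_nat le_dt.
(* The differences are nonnegative and sum to zero, so each of them vanishes. *)
have s0 : (\sum_(p | P p) (x p.1 - y p.2) = 0)%R by rewrite sumrB sx sy subrr.
have /eqP := psumr_eq0P ge0 s0 (i := (v0, i0)) (introT andP (conj v0Q Ri0)).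
rewrite subr_eq0 /x /y /= => /eqP/invr_inj/eqP; rewrite eqr_nat => /eqP.
by [].
Qed.

End Conway.

Section DeBruijnErdos.
Variables (T I : finType) (L : I -> {set T}) (Q : {set T}).
Hypothesis covered : {in Q, forall x, exists i, x \in L i}.
Hypothesis lineP : {in Q &, forall x y, x != y -> exists i, x \in L i /\ y \in L i}.
Hypothesis linear : forall i j x y, i != j -> x != y ->
  x \in L i -> y \in L i -> x \in L j -> y \in L j -> False.
Hypothesis notin_line : forall i, ~~ (Q \subset L i).
(* As the de Bruijn-Erdos theorem is the reverse inequality, this is its
   equality case. *)
Hypotheses (I0 : 0 < #|I|) (leIQ : #|I| <= #|Q|).

Let r v := #|[set i | v \in L i]|.
Let s i := #|Q :&: L i|.

(** Send a point of [Q :&: L i] to the line joining it to [v]. This is injective, as two lines share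
    at most one point; if moreover [r v <= s i], it reaches every line through [v]. *)
Lemma line_through_meets v i : v \in Q -> v \notin L i ->
  s i <= r v /\
  (r v <= s i -> forall j, v \in L j -> exists x, [/\ x \in Q, x \in L i & x \in L j]).
Proof.
move=> vQ vi.
pose f x := odflt i [pick j | (v \in L j) && (x \in L j)].
have fP x : x \in Q :&: L i -> (v \in L (f x)) && (x \in L (f x)).
  rewrite inE => /andP[xQ xi]; rewrite /f; case: pickP => //= h.
  have [|j [vj xj]] := lineP vQ xQ; first by apply: contraNneq vi => ->.
  by have := h j; rewrite vj xj.
have fI : {in Q :&: L i &, injective f}.
  move=> x y xQi yQi fxy; apply/eqP/negPn/negP => xy.
  have /andP[vx xx] := fP _ xQi; have /andP[_ yy] := fP _ yQi; rewrite -fxy in yy.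
  move: xQi yQi; rewrite !inE => /andP[_ xi] /andP[_ yi].
  apply: (linear (i := i) (j := f x) _ xy) => //.
  by apply: contraNneq vi => ->.
have sub : f @: (Q :&: L i) \subset [set j | v \in L j].
  by apply/subsetP => _ /imsetP[x /fP/andP[vx _] ->]; rewrite inE.
rewrite /s -(card_in_imset fI); split; first exact: subset_leq_card.
move=> le j vj.
have : j \in f @: (Q :&: L i).
  have /eqP -> : f @: (Q :&: L i) == [set j | v \in L j] by rewrite eqEcard sub.
  by rewrite inE.
case/imsetP=> x xQi jx; have /andP[_ xx] := fP _ xQi; exists x.
by rewrite jx; move: xQi; rewrite inE => /andP[].
Qed.

(** Take [y] off some line through [v], then [z] off the line [v y]: the line [y z] misses [v]. This
    gives the positivity that [conway_weights] asks for. *)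
Lemma line_missing v : v \in Q -> exists i, v \notin L i.
Proof.
move=> vQ; have [i vi] := covered vQ.
have /subsetPn[y yQ yi] := notin_line i.
have vy : v != y by apply: contraNneq yi => <-.
have [l [vl yl]] := lineP vQ yQ vy.
have /subsetPn[z zQ zl] := notin_line l.
have yz : y != z by apply: contraNneq zl => <-.
have [j [yj zj]] := lineP yQ zQ yz.
exists j; apply/negP => vj; apply: (linear (i := l) (j := j) _ vy) => //.
by apply: contraNneq zl => ->.
Qed.

(** Apply [conway_weights] to non-incidence: its inequality amounts to [#|I| * s i <= #|Q| * r v],
    which follows factor by factor. Equality of these products, with [r v] and [#|I|] positive,
    makes the factors agree. *)
Lemma nonincident_eq v i : v \in Q -> v \notin L i -> r v = s i /\ #|Q| = #|I|.
Proof.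
move=> vQ vi.
pose R v i := v \notin L i.
have dE w : #|[set j | R w j]| = #|I| - r w.
  rewrite cardsCs; congr (_ - #|pred_of_set _|).
  by apply/setP => j; rewrite !inE negbK.
have tE j : #|[set w in Q | R w j]| = #|Q| - s j.
  rewrite /s -cardsD; congr #|pred_of_set _|.
  by apply/setP => w; rewrite !inE andbC.
have Q0 : 0 < #|Q| by apply/card_gt0P; exists v.
have sQ j : s j <= #|Q| by apply: subset_leq_card; exact: subsetIl.
have rI w : r w <= #|I| by exact: max_card.
have := @conway_weights T I Q R Q0 I0 _ _ _ v vQ i vi.
rewrite dE tE => h; have {h}: #|Q| * (#|I| - r v) = #|I| * (#|Q| - s i).
  apply: h.
  - move=> w /line_missing[j wj]; apply/card_gt0P; exists j; by rewrite inE.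
  - move=> j; have /subsetPn[w wQ wj] := notin_line j.
    by apply/card_gt0P; exists w; rewrite inE wQ.
  - move=> w wQ j wj; rewrite dE tE !mulnBr [#|I| * _]mulnC leq_sub2l //.
    have [sr _] := line_through_meets wQ wj; exact: leq_mul.
have [sr _] := line_through_meets vQ vi.
have r0 : 0 < r v by have [j vj] := covered vQ; apply/card_gt0P; exists j; rewrite inE.
have := sQ i; have := rI v.
move: (r v) (s i) (#|Q|) (#|I|) sr r0 I0 leIQ => a c n b; nia.
Qed.

(** For [u] off [L i], [s i = r u > 0] gives a point [v] of [Q] on [L i]. If [v] is off [L j], then
    [r v = s j], so every line through [v], in particular [L i], meets [L j] in [Q]. *)
Lemma de_bruijn_erdos_meet i j : i != j ->
  exists v, [/\ v \in Q, v \in L i & v \in L j].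
Proof.
move=> ij; have /subsetPn[u uQ ui] := notin_line i.
have [ru _] := nonincident_eq uQ ui.
have : 0 < s i.
  have [l ul] := covered uQ.
  by rewrite -ru; apply/card_gt0P; exists l; rewrite inE.
case/card_gt0P=> v; rewrite inE => /andP[vQ vi].
case: (boolP (v \in L j)) => vj; first by exists v.
have [rv _] := nonincident_eq vQ vj.
have [_ h] := line_through_meets vQ vj.
by have [|x [xQ xj xi]] := h _ i vi; [rewrite rv | exists x].
Qed.

Lemma de_bruijn_erdos_card : #|Q| = #|I|.
Proof.
case/card_gt0P: I0 => i _; have /subsetPn[u uQ ui] := notin_line i.
by have [] := nonincident_eq uQ ui.
Qed.

End DeBruijnErdos.

(** * Unions of [k] copies of [K_k] *)

Lemma clique_not_dp_colorable (T : finType) (e : rel T) (K : {set T}) m :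
  {in K &, forall x y, x != y -> e x y} -> m < #|K| -> ~ dp_colorable e m.
Proof.
move=> clK mK col.
(* With identity matchings a DP-colouring is an ordinary proper colouring, hence injective on
   [K]. *)
have [|f fP] := col (fun _ _ i j => i == j).
  by split=> [u v i j|u v i j j' /eqP <- /eqP <-//]; rewrite eq_sym.
have fI : {in K &, injective f}.
  move=> x y xK yK fxy; apply/eqP/negPn/negP => /(clK _ _ xK yK)/fP.
  by rewrite fxy eqxx.
by have := max_card [pred i in f @: K]; rewrite card_in_imset // card_ord leqNgt mK.
Qed.

Section CliqueUnion.
Variables (T : finType) (e : rel T) (k : nat) (L : 'I_k -> {set T}).
Hypothesis cardL : forall i, #|L i| = k.
Hypothesis linear : forall i j x y, i != j -> x != y ->
  x \in L i -> y \in L i -> x \in L j -> y \in L j -> False.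
Hypothesis edgeL : forall x y, e x y -> exists i, x \in L i /\ y \in L i.

Definition multiple : {set T} :=
  [set v | [exists i, exists j, [&& i != j, v \in L i & v \in L j]]].

Lemma multipleP v :
  reflect (exists i j, [/\ i != j, v \in L i & v \in L j]) (v \in multiple).
Proof.
rewrite inE; apply: (iffP existsP) => [[i /existsP[j /and3P[]]]|[i [j [ij vi vj]]]].
  by exists i, j.
by exists i; apply/existsP; exists j; rewrite ij vi.
Qed.

(** Each of these vertices lies in a second clique; different ones get different second cliques, as
    two cliques share at most one vertex, and only [k - 1] are available. *)
Lemma card_multiple_line i : #|multiple :&: L i| < k.
Proof.
pose f v := odflt i [pick j | (j != i) && (v \in L j)].
have fP v : v \in multiple :&: L i -> (f v != i) && (v \in L (f v)).
  rewrite in_setI => /andP[/multipleP[j [j' [jj' vj vj']]] vi].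
  rewrite /f; case: pickP => //= h; have := h j; have := h j'.
  rewrite vj vj' !andbT => /negbFE/eqP j'i /negbFE/eqP ji.
  by rewrite ji j'i eqxx in jj'.
have fI : {in multiple :&: L i &, injective f}.
  move=> v w vi wi fvw; apply/eqP/negPn/negP => vw.
  have /andP[fi vf] := fP _ vi; have /andP[_ wf] := fP _ wi; rewrite -fvw in wf.
  move: vi wi; rewrite !in_setI => /andP[_ vi] /andP[_ wi].
  exact: (linear fi vw).
rewrite -(card_in_imset fI).
apply: leq_ltn_trans (_ : #|[set~ i]| < k).
  apply: subset_leq_card; apply/subsetP => _ /imsetP[v /fP/andP[vf _] ->].
  by rewrite !inE.
by rewrite cardsC1 card_ord ltn_predL (leq_ltn_trans (leq0n i)).
Qed.

(** By [card_multiple_line] no [L i] contains [Q], so the de Bruijn-Erdos lemmas apply with [k]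
    lines on at least [k] points. *)
Lemma big_clique_multiple (Q : {set T}) :
  Q \subset multiple -> {in Q &, forall x y, x != y -> e x y} -> k <= #|Q| ->
  #|multiple| <= k.
Proof.
move=> /subsetP Qm clQ kQ.
case: (posnP k) => [k0|k0].
  suff -> : multiple = set0 by rewrite cards0.
  apply/setP => v; rewrite in_set0.
  by apply/negP => /multipleP[i _]; have := ltn_ord i; rewrite {2}k0.
have covered : {in Q, forall x, exists i, x \in L i}.
  by move=> x /Qm/multipleP[i [_ [_ xi _]]]; exists i.
have lineP : {in Q &, forall x y, x != y -> exists i, x \in L i /\ y \in L i}.
  by move=> x y xQ yQ xy; apply: edgeL; exact: clQ.
have notin_line i : ~~ (Q \subset L i).
  apply/negP => /subsetP Qi.
  have := card_multiple_line i; rewrite ltnNge => /negP; apply.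
  apply: leq_trans kQ _; apply: subset_leq_card; apply/subsetP => x xQ.
  by rewrite in_setI Qm ?Qi.
have I0 : 0 < #|'I_k| by rewrite card_ord.
have leIQ : #|'I_k| <= #|Q| by rewrite card_ord.
have <- : #|Q| = k.
  by rewrite (de_bruijn_erdos_card covered lineP linear notin_line I0 leIQ) card_ord.
(* [w] is the only common point of [L i] and [L j], and these meet in [Q]. *)
apply: subset_leq_card; apply/subsetP => w /multipleP[i [j [ij wi wj]]].
have [v [vQ vi vj]] := de_bruijn_erdos_meet covered lineP linear notin_line I0 leIQ ij.
by case: (eqVneq v w) => [<-//|vw]; case: (linear ij vw vi wi vj wj).
Qed.

Lemma degree_simple v : irreflexive e -> (exists i, v \in L i) -> v \notin multiple ->
  #|[set w | e v w]| < k.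
Proof.
move=> irr [i vi] vm.
have -> : k = #|L i :\ v|.+1 by have := cardsD1 v (L i); rewrite vi cardL.
rewrite ltnS; apply: subset_leq_card; apply/subsetP => w; rewrite !inE => vw.
have [j [vj wj]] := edgeL vw.
have ij : i = j.
  by apply/eqP/negPn/negP => ij; case/multipleP: vm; exists i, j.
by rewrite ij wj andbT; apply: contraTneq vw => ->; rewrite irr.
Qed.

End CliqueUnion.

Theorem theorem3p2 (T : finType) (e : rel T) (k : nat) (L : 'I_k -> {set T}) :
  simple_graph e ->
  0 < k ->
  graph_NC e ->
  (* each L i is a complete subgraph on k vertices *)
  (forall i, #|L i| = k) ->
  (forall i x y, x \in L i -> y \in L i -> x != y -> e x y) ->
  (* pairwise edge-disjoint *)
  (forall i j, i != j -> forall x y, e x y ->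
     x \in L i -> y \in L i -> x \in L j -> y \in L j -> False) ->
  (* V(G) and E(G) are the unions *)
  (forall v, exists i, v \in L i) ->
  (forall x y, e x y -> exists i, x \in L i /\ y \in L i) ->
  dp_chromatic_number_is e k.
Proof.
move=> [sym irr] k0 [C [[_ cov] NC]] cardL clL disjL covL edgeL.
(* Two common vertices of complete subgraphs would span a common edge. *)
have linear i j x y : i != j -> x != y ->
    x \in L i -> y \in L i -> x \in L j -> y \in L j -> False.
  by move=> ij xy xi yi xj yj; apply: (disjL i j ij x y) => //; exact: (clL i).
split; last first.
  move=> m mk; pose i0 := Ordinal k0.
  by apply: (@clique_not_dp_colorable _ _ (L i0)); [exact: clL | rewrite cardL].
apply: greedy_dp_colorable => // U U0.
have below v (N : {set T}) : v \in N -> #|N| <= k -> #|[set w in N | e v w]| < k.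
  move=> vN; apply: leq_trans; apply: proper_card; rewrite properE.
  apply/andP; split; first by apply/subsetP => w; rewrite inE => /andP[].
  by apply/subsetPn; exists v; rewrite // inE irr andbF.
case: (boolP (U \subset multiple L)) => [Um|/subsetPn[v vU vm]]; last first.
  exists v => //; apply: leq_ltn_trans (degree_simple cardL edgeL irr (covL v) vm).
  by apply: subset_leq_card; apply/subsetP => w; rewrite !inE => /andP[].
case: (leqP #|multiple L| k) => [mk|km].
  have [v vU] := set0Pn _ U0; exists v => //; apply: below => //.
  by apply: leq_trans mk; exact: subset_leq_card.
have [e' [[sym' irr'] sub nh e'P]] := chordalization sym irr cov NC.
have [v vU vs] := chordal_simplicial sym' irr' nh U0; exists v => //.
(* As [v] is simplicial, [K] is a clique of [e']; up to one vertex it is a clique of [e], with fewer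
   than [k] vertices because [multiple] has more than [k]. Hence [#|K| <= k], and [v] has fewer than
   [k] neighbours in [U]. *)
pose K := v |: [set w in U | e' v w].
have clK : {in K &, forall x y, x != y -> e' x y}.
  move=> x y; rewrite !inE => /orP[/eqP->|/andP[xU vx]] /orP[/eqP->|/andP[yU vy]].
  - by rewrite eqxx.
  - by [].
  - by rewrite sym'.
  - exact: vs.
have [K' [K'K leK clK']] := chordalization_clique sym irr NC e'P clK.
have KU : K \subset U by apply/subsetP => w; rewrite !inE => /orP[/eqP->//|/andP[]].
have K'k : #|K'| < k.
  rewrite ltnNge; apply: contraL km => kK'; rewrite -leqNgt.
  apply: (big_clique_multiple linear edgeL _ clK' kK').
  exact: subset_trans K'K (subset_trans KU Um).
apply: leq_ltn_trans (below v K _ _).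
- apply: subset_leq_card; apply/subsetP => w; rewrite !inE => /andP[wU vw].
  by rewrite wU vw sub // orbT.
- by rewrite !inE eqxx.
- by lia.
Qed.
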